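(* Let $k\ge 1$ be an integer and let $G$ be a connected graph of order $n$ with matching number $k$. Then $$\rho(G)\ \ge\ \sqrt{\frac{n+2k-3}{k}}.$$ Equality holds if and only if $G\in\mathcal{T}_{n,k}$.
   Context: Graphs are finite, simple and undirected. The order of a graph is its number of vertices; the matching number is the size of a maximum matching; $\rho(G)$ denotes the spectral radius of $G$, i.e. the largest eigenvalue of its adjacency matrix. Definition of the family $\mathcal{T}_{n,k}$. Let $k,n$ be positive integers with $k\mid(n-3)$ and $n\ge 2k$, and put $c:=(n+2k-3)/k$ (an integer). The family $\mathcal{T}_{n,k}$ consists of all graphs (up to isomorphism) obtained as follows. Take a tree $T_1$ on a vertex set $X=\{x_1,\dots,x_k\}$ satisfying $2d_{T_1}(x_i)\le c$ for all $i$, where $d_{T_1}(x_i)$ is the degree of $x_i$ in $T_1$. (1) Subdivide every edge of $T_1$ once: each edge $e=x_ix_j$ of $T_1$ is replaced by a new vertex $y_e$ adjacent exactly to $x_i$ and $x_j$ (so there are $k-1$ new vertices $y_e$, and no edges remain inside $X$). (2) Attach $f_i$ new pendant leaves to each $x_i$, where $f_i:=c-2d_{T_1}(x_i)\ge 0$. The resulting graph is a tree of order $n$. If $k\nmid(n-3)$, or if no suitable tree $T_1$ exists, then $\mathcal{T}_{n,k}$ is empty. *)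

(* Defs.v *)
From HB Require Import structures.
From mathcomp Require Import all_boot all_order all_algebra.
From mathcomp Require Import boolp classical_sets reals.

Set Implicit Arguments.
Unset Strict Implicit.
Unset Printing Implicit Defensive.

Import Order.TTheory GRing.Theory Num.Theory.

Section Graphs.
Variable V : finType.
Implicit Type e : rel V.

Definition simple_graph e := symmetric e /\ irreflexive e.

Definition connected_graph e := 0 < #|V| /\ forall x y, connect e x y.

(* [2 < size c] discards the closed walks x, y, x along a single edge. *)
Definition acyclic_graph e := forall c : seq V, 2 < size c -> ~ ucycle e c.

Definition tree e := [/\ simple_graph e, connected_graph e & acyclic_graph e].

Definition degree e (x : V) : nat := #|[set y | e x y]|.

Definition edges e : {set {set V}} := [set [set x; y] | x in V, y in V & e x y].

Definition is_matching e (M : {set {set V}}) : bool :=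
  (M \subset edges e) && finset.trivIset M.

Definition matching_number e : nat :=
  \max_(M : {set {set V}} | is_matching e M) #|M|.

Definition adjacency_matrix (R : realType) e : 'M[R]_#|V| :=
  (\matrix_(i, j) (e (enum_val i) (enum_val j))%:R)%R.

(* The largest eigenvalue: the element of the spectrum that is an upper bound of
   it. It exists because the matrix is real symmetric of positive size (for the
   empty graph, the value is the default 0). *)
Definition spectral_radius (R : realType) e : R :=
  let spectrum := [set a : R | eigenvalue (adjacency_matrix R e) a]%classic in
  xget 0%R (spectrum `&` ubound spectrum)%classic.

End Graphs.

Definition isomorphic (U V : finType) (d : rel U) (e : rel V) : Prop :=
  exists2 f : U -> V, bijective f & forall u v, e (f u) (f v) = d u v.

Section Construction.
Variables (X : finType) (t : rel X) (f : X -> nat).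

(* The vertices are the original ones, one vertex per edge of [t], and [f x]
   leaves at each [x]. *)
Definition subdivided_vertex : finType :=
  ((X + {a : {set X} | a \in edges t}) + {x : X & 'I_(f x)})%type.

Definition subdivided_rel : rel subdivided_vertex := fun u v =>
  match u, v with
  | inl (inl x), inl (inr a) | inl (inr a), inl (inl x) => x \in val a
  | inl (inl x), inr l | inr l, inl (inl x) => x == tag l
  | _, _ => false
  end.

End Construction.

(* Under [2 * k <= n] and [0 < k] the truncated subtractions below are exact;
   [n - 3] is taken in [int] since it may be negative. *)
Definition in_family (n k : nat) (V : finType) (e : rel V) : Prop :=
  let c := (n + 2 * k - 3) %/ k in
  [/\ 0 < n, 0 < k, (k%:Z %| (n%:Z - 3)%R)%Z, 2 * k <= n &
   exists t : rel 'I_k,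
     [/\ tree t,
         forall i, 2 * degree t i <= c &
         isomorphic (@subdivided_rel _ t (fun i => c - 2 * degree t i)) e]].

(* Main.v *)
Require Import Defs.
From HB Require Import structures.
From mathcomp Require Import all_boot all_order all_algebra.
From mathcomp Require Import boolp classical_sets reals.
From mathcomp Require Import ring lra zify.

(** The lower bound comes from one explicit test vector in the Rayleigh quotient,
    built on a spanning tree rather than on the graph itself.

    Root a spanning tree at [r] and let [X] be the greedy vertex cover of the
    tree: going up from the leaves, a vertex is taken when one of its children was
    not. Matching each vertex of [X] with such a child shows that
    [k' = #|X| <= k] ([rooted_cover]); moving the root to a child if necessary,
    [r] lies in [X]. Put [s = sqrt ((n + 2k' - 3) / k')]. The test vector is [s] on
    [X], and on a vertex [y] outside [X] it is the number [d(y)] of its tree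
    neighbours, all of which lie in [X]. Let [D] be the sum of the [d(y)^2] and [I]
    the number of tree edges inside [X]. The squared norm is [s^2 k' + D], and the
    quadratic form of the tree is [2sD + 2s^2 I]. The numbers [d(y)] are positive
    integers, so [d^2 >= 3d - 2], and they add up to [n - 1 - I]; hence
    [D >= n + 2k' - 3 - 3I = s^2 k' - 3I]. The form therefore exceeds [s] times the
    squared norm by at least [s (2s - 3) I]. This is nonnegative: if [I > 0] then
    [k' >= 2], and [n >= 2k'] gives [s^2 >= 5/2 > 9/4]. So [s] is a lower bound for
    the spectral radius ([tree_bound]), and it decreases when [k'] grows to [k].

    In case of equality [k' = k] and nothing was lost ([tree_bound_eq]): [I = 0],
    every [d(y)] is 1 or 2, the graph has no edge besides those of the tree, and the
    test vector is an eigenvector. The vertices outside [X] with [d(y) = 2]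
    subdivide the edges of the tree on [X] that joins each vertex to its
    grandparent, those with [d(y) = 1] are leaves, and the eigenvector equation at
    [x] in [X] says that twice the degree of [x] in that tree plus the number of
    leaves at [x] equals [s^2] ([grandparent_tree_isomorphism]).

    Conversely, on a member of the family with parameter [c] the vector equal to
    [sqrt c] on the original vertices, 2 on the subdivision vertices and 1 on the
    leaves is an eigenvector for [sqrt c]; being positive, it belongs to the spectral
    radius ([positive_eigenvector]). *)

Set Implicit Arguments.
Unset Strict Implicit.
Unset Printing Implicit Defensive.

Import Order.TTheory GRing.Theory Num.Theory.
Local Open Scope ring_scope.

(** * Rayleigh quotients of real symmetric matrices *)

Definition dotv (R : realType) m (u v : 'rV[R]_m) : R := (u *m v^T) 0 0.

Lemma dotvE (R : realType) m (u v : 'rV[R]_m) :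
  dotv u v = \sum_i u 0 i * v 0 i.
Proof. by rewrite /dotv mxE; apply: eq_bigr => i _; rewrite mxE. Qed.

Lemma dotvC (R : realType) m (u v : 'rV[R]_m) : dotv u v = dotv v u.
Proof. by rewrite !dotvE; apply: eq_bigr => i _; rewrite mulrC. Qed.

Lemma dotvDl (R : realType) m (u v w : 'rV[R]_m) :
  dotv (u + v) w = dotv u w + dotv v w.
Proof. by rewrite /dotv mulmxDl mxE. Qed.

Lemma dotvZl (R : realType) m a (u v : 'rV[R]_m) :
  dotv (a *: u) v = a * dotv u v.
Proof. by rewrite /dotv -scalemxAl mxE. Qed.

Lemma dotvDr (R : realType) m (u v w : 'rV[R]_m) :
  dotv w (u + v) = dotv w u + dotv w v.
Proof. by rewrite dotvC dotvDl !(dotvC w). Qed.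

Lemma dotvZr (R : realType) m a (u v : 'rV[R]_m) :
  dotv u (a *: v) = a * dotv u v.
Proof. by rewrite dotvC dotvZl dotvC. Qed.

Lemma dotv_mulmx (R : realType) m (A : 'M[R]_m) (u v : 'rV[R]_m) :
  dotv (u *m A) v = dotv u (v *m A^T).
Proof. by rewrite /dotv trmx_mul trmxK mulmxA. Qed.

Lemma dotv_ge0 (R : realType) m (u : 'rV[R]_m) : 0 <= dotv u u.
Proof. by rewrite dotvE sumr_ge0 // => i _; rewrite -expr2 sqr_ge0. Qed.

Lemma dotv_eq0 (R : realType) m (u : 'rV[R]_m) : dotv u u = 0 -> u = 0.
Proof.
rewrite dotvE => /eqP; rewrite psumr_eq0 => [/allP u0|i _]; last first.
  by rewrite -expr2 sqr_ge0.
apply/rowP => i; rewrite mxE; apply/eqP.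
by have := u0 i (mem_index_enum i); rewrite /= mulf_eq0 orbb.
Qed.

Lemma dotv_gt0 (R : realType) m (u : 'rV[R]_m) : u != 0 -> 0 < dotv u u.
Proof.
move=> u_neq0; rewrite lt_def dotv_ge0 andbT.
by apply: contra u_neq0 => /eqP/dotv_eq0 ->.
Qed.

Lemma quad_bounded (R : realType) m (A : 'M[R]_m) :
  exists2 K : R, 0 < K & forall u, dotv (u *m A) u <= K * dotv u u.
Proof.
exists (1 + \sum_i \sum_j `|A i j|) => [|u].
  by rewrite ltr_wpDr // sumr_ge0 // => i _; rewrite sumr_ge0.
have coord_le i : u 0 i ^+ 2 <= dotv u u.
  rewrite dotvE (bigD1 i) //= -expr2 lerDl sumr_ge0 // => j _.
  by rewrite -expr2 sqr_ge0.
rewrite mulrDl mul1r ler_wpDl ?dotv_ge0 // [leLHS]dotvE exchange_big /=.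
rewrite big_distrl /=; apply: ler_sum => j _.
rewrite mxE !big_distrl /=; apply: ler_sum => i _.
rewrite mulrAC mulrC; apply: le_trans (ler_norm _) _; rewrite normrM.
apply: ler_wpM2l => //; rewrite normrM.
have := coord_le i; have := coord_le j.
rewrite -(real_normK (num_real (u 0 i))) -(real_normK (num_real (u 0 j))).
by move=> *; nra.
Qed.

(** Expand the form of [B] at [u - t *: (u *m B)]: it is nonnegative for every [t],
    and [t = K^-1], with [K] a bound for the form of [B], gives the claim. In
    particular, a vector on which the form vanishes is in the kernel. *)
Lemma psd_image_bounded (R : realType) m (B : 'M[R]_m) : B^T = B ->
  (forall u, 0 <= dotv (u *m B) u) ->
  exists2 K : R, 0 < K &
    forall u, dotv (u *m B) (u *m B) <= K * dotv (u *m B) u.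
Proof.
move=> B_sym B_psd; have [K K_gt0 leK] := quad_bounded B.
exists K => // u; set w := u *m B.
have := B_psd (u + (- K^-1) *: w); rewrite mulmxDl -scalemxAl -/w.
rewrite !(dotvDl, dotvDr, dotvZl, dotvZr).
have -> : dotv (w *m B) u = dotv w w by rewrite dotv_mulmx B_sym.
have := leK w; set q := dotv (w *m B) w; set a := dotv w w.
set b := dotv w u => q_le ineq.
have Kq : K^-1 * q <= a by rewrite ler_pdivrMl.
have K1 : 0 < K^-1 by rewrite invr_gt0.
have : 0 <= b - K^-1 * a by nra.
by rewrite subr_ge0 ler_pdivrMl.
Qed.

(** The supremum [lam] of the Rayleigh quotients is an eigenvalue, without any
    compactness: the form of [B = lam - A] is nonnegative, and if [B] were
    invertible, [psd_image_bounded] would bound it below by a positive multiple of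
    the squared norm, so [lam] could be lowered. *)
Lemma symmetric_top_eigenvalue (R : realType) m (A : 'M[R]_m) :
    (0 < m)%N -> A^T = A ->
  exists2 lam : R, eigenvalue A lam &
    forall u, dotv (u *m A) u <= lam * dotv u u.
Proof.
case: m A => // m A _ A_sym.
have [K _ leK] := quad_bounded A.
pose S := [set dotv (u *m A) u / dotv u u | u in [set u : 'rV[R]_m.+1 | u != 0]]%classic.
have S_sup : has_sup S.
  split.
    exists (dotv (delta_mx 0 0 *m A) (delta_mx 0 0) / dotv (delta_mx 0 0 : 'rV[R]_m.+1) (delta_mx 0 0)).
    exists (delta_mx 0 0) => //=; apply/eqP => /rowP/(_ 0) /eqP.
    by rewrite !mxE !eqxx oner_eq0.
  by exists K => _ [u u0 <-]; rewrite ler_pdivrMr ?dotv_gt0.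
have leS u : dotv (u *m A) u <= sup S * dotv u u.
  have [->|u0] := eqVneq u 0; first by rewrite mul0mx /dotv !mul0mx mxE mulr0.
  rewrite -ler_pdivrMr ?dotv_gt0 //; apply: ub_le_sup; first by case: S_sup.
  by exists u.
exists (sup S) => //; set B := (sup S)%:M - A.
have uB u : u *m B = sup S *: u - u *m A.
  by rewrite mulmxBr mul_mx_scalar.
have qB u : dotv (u *m B) u = sup S * dotv u u - dotv (u *m A) u.
  by rewrite uB dotvDl dotvZl -scaleN1r dotvZl mulN1r.
have B_psd u : 0 <= dotv (u *m B) u by rewrite qB subr_ge0.
have B_sym : B^T = B by rewrite /B linearB /= tr_scalar_mx A_sym.
have [K1 K1_gt0 leK1] := psd_image_bounded B_sym B_psd.
have [B_unit|] := boolP (B \in unitmx); last first.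
  rewrite -row_free_unit -kermx_eq0 => kerB.
  apply: contra kerB; rewrite /eigenspace => /eqP kerA.
  by rewrite -submx0 -kerA; apply/sub_kermxP; rewrite -opprB mulmxN mulmx_ker oppr0.
have [K2 K2_gt0 leK2] := quad_bounded (invmx B *m (invmx B)^T).
suff : sup S <= sup S - (K2 * K1)^-1.
  by rewrite lerBrDl gerDr leNgt invr_gt0 mulr_gt0.
apply: ge_sup; first by case: S_sup.
move=> _ [u u0 <-]; rewrite ler_pdivrMr ?dotv_gt0 //.
rewrite mulrBl lerBrDl -lerBrDr -qB ler_pdivrMl ?mulr_gt0 //.
rewrite -mulrA; apply: le_trans (_ : K2 * dotv (u *m B) (u *m B) <= _); last first.
  by rewrite ler_pM2l.
apply: le_trans (leK2 _); rewrite mulmxA mulmxK // dotv_mulmx trmxK.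
by rewrite -mulmxA mulmxV // mulmx1.
Qed.

Lemma rayleigh_equality (R : realType) m (A : 'M[R]_m) lam (u : 'rV[R]_m) :
    A^T = A -> (forall w, dotv (w *m A) w <= lam * dotv w w) ->
  dotv (u *m A) u = lam * dotv u u -> u *m A = lam *: u.
Proof.
move=> A_sym lam_top u_top.
have uB w : w *m (lam%:M - A) = lam *: w - w *m A.
  by rewrite mulmxBr mul_mx_scalar.
have qB w : dotv (w *m (lam%:M - A)) w = lam * dotv w w - dotv (w *m A) w.
  by rewrite uB dotvDl dotvZl -scaleN1r dotvZl mulN1r.
have [||K _ /(_ u)] := @psd_image_bounded R m (lam%:M - A).
- by rewrite linearB /= tr_scalar_mx A_sym.
- by move=> w; rewrite qB subr_ge0.
rewrite qB u_top subrr mulr0 => img_le0.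
have /dotv_eq0/eqP : dotv (u *m (lam%:M - A)) (u *m (lam%:M - A)) = 0.
  by apply/eqP; rewrite eq_le img_le0 dotv_ge0.
by rewrite uB subr_eq0 => /eqP ->.
Qed.

(** * The spectral radius of a graph *)

Definition vertex_row (R : realType) (V : finType) (f : V -> R) : 'rV[R]_#|V| :=
  \row_i f (enum_val i).

Lemma vertex_row_rank (R : realType) (V : finType) (f : V -> R) v :
  vertex_row f 0 (enum_rank v) = f v.
Proof. by rewrite mxE enum_rankK. Qed.

Lemma vertex_row_surj (R : realType) (V : finType) (u : 'rV[R]_#|V|) :
  u = vertex_row (fun v => u 0 (enum_rank v)).
Proof. by apply/rowP => i; rewrite mxE enum_valK. Qed.

Lemma dotv_vertex_row (R : realType) (V : finType) (f g : V -> R) :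
  dotv (vertex_row f) (vertex_row g) = \sum_v f v * g v.
Proof.
rewrite dotvE [RHS](reindex_onto enum_val enum_rank) /=; last first.
  by move=> v _; rewrite enum_rankK.
by apply: eq_big => [i|i _]; rewrite ?enum_valK ?eqxx // !mxE.
Qed.

Lemma vertex_row_adjacency (R : realType) (V : finType) (e : rel V) (f : V -> R) :
    symmetric e ->
  vertex_row f *m adjacency_matrix R e
    = vertex_row (fun u => \sum_v (e u v)%:R * f v).
Proof.
move=> e_sym; apply/rowP => i; rewrite !mxE.
rewrite [RHS](reindex_onto enum_val enum_rank) /=; last first.
  by move=> v _; rewrite enum_rankK.
apply: eq_big => [j|j _]; first by rewrite enum_valK eqxx.
by rewrite !mxE mulrC e_sym.
Qed.

Lemma adjacency_matrix_sym (R : realType) (V : finType) (e : rel V) :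
  symmetric e -> (adjacency_matrix R e)^T = adjacency_matrix R e.
Proof. by move=> e_sym; apply/matrixP => i j; rewrite !mxE e_sym. Qed.

Lemma spectral_radiusP (R : realType) (V : finType) (e : rel V) :
    symmetric e -> (0 < #|V|)%N ->
  eigenvalue (adjacency_matrix R e) (spectral_radius R e) /\
  forall u, dotv (u *m adjacency_matrix R e) u <= spectral_radius R e * dotv u u.
Proof.
move=> e_sym V_gt0.
have [lam lam_eig lam_top] :=
  symmetric_top_eigenvalue V_gt0 (adjacency_matrix_sym R e_sym).
have lam_ub : ubound [set a : R | eigenvalue (adjacency_matrix R e) a]%classic lam.
  move=> a /= /eigenvalueP[w wA w_neq0].
  have := lam_top w; rewrite wA dotvZl ler_pM2r //; exact: dotv_gt0.
have [rho_eig rho_ub] : ([set a : R | eigenvalue (adjacency_matrix R e) a]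
      `&` ubound [set a | eigenvalue (adjacency_matrix R e) a])%classic
    (spectral_radius R e).
  by apply: (xgetI 0); split; [exact: lam_eig|exact: lam_ub].
split=> // u; apply: le_trans (lam_top u) _.
by rewrite ler_wpM2r ?dotv_ge0 //; apply: rho_ub.
Qed.

Lemma rayleigh_le (R : realType) (V : finType) (e : rel V) (f : V -> R) :
    symmetric e -> (0 < #|V|)%N ->
  \sum_u (\sum_v (e u v)%:R * f v) * f u
    <= spectral_radius R e * \sum_u f u * f u.
Proof.
move=> e_sym V_gt0; have [_ /(_ (vertex_row f))] := spectral_radiusP R e_sym V_gt0.
by rewrite vertex_row_adjacency // !dotv_vertex_row.
Qed.

Lemma rayleigh_eigenvector (R : realType) (V : finType) (e : rel V) (f : V -> R) :
    symmetric e -> (0 < #|V|)%N ->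
    \sum_u (\sum_v (e u v)%:R * f v) * f u
      = spectral_radius R e * \sum_u f u * f u ->
  forall u, \sum_v (e u v)%:R * f v = spectral_radius R e * f u.
Proof.
move=> e_sym V_gt0 f_eq u.
have [_ top] := spectral_radiusP R e_sym V_gt0.
have := @rayleigh_equality _ _ _ _ (vertex_row f) (adjacency_matrix_sym R e_sym) top.
rewrite vertex_row_adjacency // !dotv_vertex_row => /(_ f_eq) /rowP/(_ (enum_rank u)).
by rewrite mxE [RHS]mxE vertex_row_rank enum_rankK.
Qed.

(** Bound the form at an eigenvector [g] for the spectral radius by applying
    [2 g(u) g(v) <= g(u)^2 f(v)/f(u) + g(v)^2 f(u)/f(v)] to each edge; the right-hand
    sides add up to twice [mu] times the squared norm of [g]. *)
Lemma positive_eigenvector (R : realType) (V : finType) (e : rel V)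
    (f : V -> R) (mu : R) :
    symmetric e -> (0 < #|V|)%N -> (forall u, 0 < f u) ->
    (forall u, \sum_v (e u v)%:R * f v = mu * f u) ->
  spectral_radius R e = mu.
Proof.
move=> e_sym V_gt0 f_gt0 f_eig.
have [/eigenvalueP[w wA w_neq0] _] := spectral_radiusP R e_sym V_gt0.
apply/eqP; rewrite eq_le; apply/andP; split.
  rewrite -(ler_pM2r (dotv_gt0 w_neq0)) -dotvZl -wA.
  pose g v := w 0 (enum_rank v).
  have -> : w = vertex_row g by apply: vertex_row_surj.
  rewrite vertex_row_adjacency // !dotv_vertex_row.
  (* Summing over the neighbours [v] of [u] turns [f v / f u] into [mu]. *)
  have scale_sum : \sum_u (\sum_v (e u v)%:R * (f v / f u)) * g u ^+ 2
      = mu * \sum_u g u * g u.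
    rewrite big_distrr; apply: eq_bigr => u _ /=.
    under eq_bigr do rewrite mulrA.
    by rewrite -big_distrl /= f_eig mulfK ?gt_eqF // expr2.
  rewrite -(ler_pM2l (ltr0n R 2)) -scale_sum [X in _ <= X]mulr_natl mulr2n.
  have swap_sum : \sum_u (\sum_v (e u v)%:R * (f v / f u)) * g u ^+ 2
      = \sum_u \sum_v (e u v)%:R * (f u / f v) * g v ^+ 2.
    under eq_bigr do rewrite big_distrl /=.
    rewrite exchange_big /=; apply: eq_bigr => u _; apply: eq_bigr => v _.
    by rewrite e_sym.
  rewrite [X in _ <= X + _]swap_sum -big_split /= big_distrr /=.
  apply: ler_sum => u _; rewrite big_distrl big_distrr big_distrl -big_split /=.
  apply: ler_sum => v _; rewrite -!mulrA mulrCA -mulrDr ler_wpM2l ?ler0n //.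
  have [fu fv] := (f_gt0 u, f_gt0 v).
  rewrite -subr_ge0; suff -> : f u * ((f v)^-1 * g v ^+ 2)
      + f v * ((f u)^-1 * g u ^+ 2) - 2 * (g v * g u)
      = (f u * f v)^-1 * (f u * g v - f v * g u) ^+ 2.
    by rewrite mulr_ge0 ?sqr_ge0 // invr_ge0 ltW // mulr_gt0.
  by field; rewrite !gt_eqF.
have f2_gt0 : 0 < \sum_u f u * f u.
  have /card_gt0P[u _] := V_gt0.
  rewrite (bigD1 u) //= ltr_pwDl ?mulr_gt0 // sumr_ge0 // => v _.
  by rewrite mulr_ge0 // ltW.
rewrite -(ler_pM2r f2_gt0); apply: le_trans (rayleigh_le f e_sym V_gt0).
under [leRHS]eq_bigr do rewrite f_eig.
by rewrite big_distrr /=; under eq_bigr do rewrite mulrA.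
Qed.

Local Close Scope ring_scope.

(** * Edges and matchings *)

Lemma edgesP (V : finType) (e : rel V) (a : {set V}) :
  reflect (exists x y, e x y /\ a = [set x; y]) (a \in edges e).
Proof.
apply: (iffP imset2P) => [[x y _ exy ->]|[x [y [exy ->]]]].
  by exists x, y; split=> //; move: exy; rewrite inE.
by exists x y; rewrite ?inE.
Qed.

Lemma card_edge (V : finType) (e : rel V) (a : {set V}) :
  irreflexive e -> a \in edges e -> #|a| = 2.
Proof.
move=> e_irr /edgesP[x [y [exy ->]]]; rewrite cards2.
by case: eqP exy => // ->; rewrite e_irr.
Qed.

Lemma matching_number_double (V : finType) (e : rel V) :
  irreflexive e -> 2 * matching_number e <= #|V|.
Proof.
move=> e_irr; rewrite mulnC -leq_divRL //; apply/bigmax_leqP => M.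
case/andP=> /fintype.subsetP subM /eqP triv_M; rewrite leq_divRL //.
rewrite -sum_nat_const (eq_bigr (fun a : {set V} => #|a|)) => [|a aM].
  by rewrite triv_M max_card.
by rewrite (card_edge e_irr) // subM.
Qed.

(** * Rooted spanning trees and the greedy cover *)

(** Outside [r], [p v] is the parent of [v]; the height [h] decreases towards
    the root, which rules out cycles. *)
Definition parent_map (T : finType) (r : T) (p : T -> T) (h : T -> nat) : Prop :=
  forall v, v != r -> h (p v) < h v.

Definition child (T : eqType) (r : T) (p : T -> T) : rel T :=
  fun w v => (w != r) && (p w == v).

(** The height is the length of a shortest walk to [r], and the parent a neighbour
    of smaller height. *)
Lemma spanning_parent_map (V : finType) (e : rel V) (r : V) :
    connected_graph e ->
  exists p h, parent_map r p h /\ forall v, v != r -> e v (p v).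
Proof.
case=> _ e_conn.
have walk v : exists n, [exists t : n.-tuple V, path e v t && (last v t == r)].
  have /connectP[s s_path s_last] := e_conn v r; exists (size s).
  by apply/existsP; exists (in_tuple s); rewrite s_path -s_last eqxx.
pose h v := ex_minn (walk v).
pose p v := odflt v [pick w | e v w && (h w < h v)].
have pP v : v != r -> e v (p v) && (h (p v) < h v).
  move=> v_r; rewrite /p; case: pickP => //= no_w.
  have := no_w; rewrite {2}/h; case: ex_minnP => n /existsP[t].
  case: n t => [|n] t.
    by rewrite (tuple0 t) /= => v_r'; rewrite v_r' in v_r.
  case/tupleP: t => w t /= /andP[/andP[evw t_path] t_last] _ /(_ w).
  rewrite evw /h /=; case: ex_minnP => m _ /(_ n) m_le; rewrite ltnS m_le //.
  by apply/existsP; exists t; rewrite t_path.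
by exists p, h; split=> v /pP/andP[].
Qed.

(** The rule determines membership from the leaves upwards, since heights are
    bounded. An edge from a vertex left out to its parent puts the parent in the
    set, so the set is a vertex cover of the tree. *)
Lemma greedy_cover (T : finType) (r : T) (p : T -> T) (h : T -> nat) :
    parent_map r p h ->
  exists X : {set T}, forall v,
    (v \in X) = [exists w, child r p w v && (w \notin X)].
Proof.
move=> ph.
(* [inX n] applies the rule [n] times; its value at [v] no longer changes once [n]
   exceeds the height of the tallest vertex minus that of [v]. *)
pose inX := fix inX n v {struct n} :=
  if n is n'.+1 then [exists w, child r p w v && ~~ inX n' w] else false.
pose H := \max_v h v.
have h_le v : h v <= H by apply: leq_bigmax.
have stable n n' v : H - h v < n -> H - h v < n' -> inX n v = inX n' v.
  elim: n n' v => // n IHn [|n'] // v Hn Hn' /=.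
  apply: eq_existsb => w; rewrite /child; case: (altP (w =P r)) => //= w_r.
  case: eqP => //= pw; congr (~~ _); have := ph _ w_r; rewrite pw => h_vw.
  by apply: IHn; have := h_le w; lia.
exists [set v | inX H.+1 v] => v; rewrite inE (stable _ H.+2) ?ltnS ?leq_subr //; last lia.
by apply: eq_existsb => w; rewrite inE.
Qed.

(** Join each vertex of the greedy set to a child left out: these edges are
    pairwise disjoint. *)
Lemma greedy_cover_matching (V : finType) (e : rel V) (r : V) p h (X : {set V}) :
    symmetric e -> parent_map r p h -> (forall v, v != r -> e v (p v)) ->
    (forall v, (v \in X) = [exists w, child r p w v && (w \notin X)]) ->
  #|X| <= matching_number e.
Proof.
move=> e_sym ph pe X_greedy.
pose c v := odflt v [pick w | child r p w v && (w \notin X)].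
have cP v : v \in X -> [/\ c v != r, p (c v) = v & c v \notin X].
  rewrite X_greedy /c; case: pickP => [w /andP[/andP[w_r /eqP pw] wX] _|no_w].
    by split.
  by case/existsP=> w; rewrite no_w.
(* A common vertex of two of these edges is an end in [X] of both or a chosen child
   of both, and a child determines its parent. *)
have meet u v x : u \in X -> v \in X -> x \in [set u; c u] -> x \in [set v; c v] -> u = v.
  move=> uX vX; have [_ pcu cuX] := cP u uX; have [_ pcv cvX] := cP v vX.
  rewrite !inE => /orP[]/eqP-> /orP[]/eqP // uv.
  - by rewrite uv (negPf cvX) in uX.
  - by rewrite -uv (negPf cuX) in vX.
  - by rewrite -pcu uv.
rewrite -(card_in_imset (f := fun u => [set u; c u])); last first.
  move=> u v uX vX /= eq_uv; apply: (meet u v u) => //; first by rewrite finset.set21.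
  by rewrite -eq_uv finset.set21.
apply: leq_bigmax_cond; apply/andP; split.
  apply/fintype.subsetP => _ /imsetP[u uX ->]; apply/edgesP; exists u, (c u).
  by have [c_r pc _] := cP u uX; split=> //; rewrite e_sym -{2}pc pe.
apply/finset.trivIsetP => _ _ /imsetP[u uX ->] /imsetP[v vX ->] neq.
rewrite -finset.setI_eq0; apply/eqP/finset.setP => x; rewrite [RHS]inE.
apply/negP => /finset.setIP[xu xv]; move: neq.
by rewrite (meet u v x) ?eqxx.
Qed.

(** Moving the root to one of its children changes the orientation of a single
    edge. *)
Lemma reroot (T : finType) (r x : T) p h :
    parent_map r p h -> x != r -> p x = r ->
  parent_map x (fun v => if v == r then x else p v)
    (fun v => if v == x then 0 else (h v).+1).
Proof.
move=> ph x_r px v v_x; rewrite (negPf v_x); case: (altP (v =P r)) => [->|v_r].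
  by rewrite eqxx.
by case: eqP => // _; rewrite ltnS ph.
Qed.

(** If the greedy cover leaves out the root, then it contains all the children of
    the root; moving the root to one of them keeps the tree, hence the cover. *)
Lemma rooted_cover (V : finType) (e : rel V) :
    symmetric e -> connected_graph e -> 1 < #|V| ->
  exists r p h (X : {set V}), [/\ parent_map r p h, forall v, v != r -> e v (p v),
    r \in X, forall v, v != r -> v \notin X -> p v \in X & #|X| <= matching_number e].
Proof.
move=> e_sym e_conn V_gt1.
have [V_gt0 _] := e_conn; have /card_gt0P[r _] := V_gt0.
have [p [h [ph pe]]] := spanning_parent_map r e_conn.
have [X X_greedy] := greedy_cover ph.
have X_small := greedy_cover_matching e_sym ph pe X_greedy.
have X_cover v : v != r -> v \notin X -> p v \in X.
  by move=> v_r vX; rewrite X_greedy; apply/existsP; exists v; rewrite /child v_r eqxx.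
have [rX|rX] := boolP (r \in X); first by exists r, p, h, X; split.
have [v0 v0_r] : exists v, v != r.
  have := V_gt1; rewrite (cardD1 r) inE add1n ltnS => /card_gt0P[v].
  by rewrite !inE andbT; exists v.
have [x x_r x_min] := @arg_minnP _ v0 (fun v => v != r) h v0_r.
have px : p x = r.
  by apply/eqP; apply/negPn/negP => /x_min; rewrite leqNgt ph.
have xX : x \in X by apply: contraNT rX => /(X_cover _ x_r); rewrite px.
exists x, (fun v => if v == r then x else p v).
exists (fun v => if v == x then 0 else (h v).+1), X; split=> //.
- exact: reroot.
- move=> v v_x; case: (altP (v =P r)) => [->|v_r]; last exact: pe.
  by rewrite e_sym -px pe.
- by move=> v v_x; case: (altP (v =P r)) => // v_r; apply: X_cover.
Qed.

(** * The test vector of a rooted tree with a cover *)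

Section TestVector.
Variables (V : finType) (r : V) (p : V -> V) (h : V -> nat) (X : {set V}).
Hypotheses (ph : parent_map r p h) (rX : r \in X).
Hypothesis X_cover : forall v, v != r -> v \notin X -> p v \in X.

Definition children v := #|[set w | child r p w v]|.

Definition inner_edges := #|[set x in X | (x != r) && (p x \in X)]|.

(** With [r] in [X], a vertex outside has [(children y).+1] tree neighbours. *)
Definition outer_weight := \sum_(y | y \notin X) (children y).+1 ^ 2.

Lemma child_asym u v : child r p u v -> child r p v u = false.
Proof.
case/andP=> u_r /eqP pu; apply/negP => /andP[v_r /eqP pv].
by have := ph u_r; have := ph v_r; rewrite pu pv => h1 /(ltn_trans h1); rewrite ltnn.
Qed.

(** Every vertex of [X] but the root has its parent either inside [X] or outside. *)
Lemma sum_children_outside :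
  \sum_(y | y \notin X) children y + inner_edges + 1 = #|X|.
Proof.
have -> : \sum_(y | y \notin X) children y = #|[set x in X | (x != r) && (p x \notin X)]|.
  rewrite -[RHS]sum1_card [RHS](partition_big p (fun y => y \notin X)) /=; last first.
    by move=> x; rewrite !inE => /and3P[].
  apply: eq_bigr => y yX; rewrite /children -sum1_card.
  apply: eq_bigl => w; rewrite !inE /child; case: (altP (w =P r)) => [|w_r] /=.
    by rewrite andbF.
  case: eqP => [pw|]; last by rewrite !andbF.
  rewrite pw yX !andbT; apply/esym; apply: contraNT yX => wX.
  by rewrite -pw X_cover.
rewrite [RHS](cardsD1 r) rX addnC; congr (_ + _).
rewrite -(cardsID [set x | p x \in X] (X :\ r)) addnC /inner_edges.
by congr (_ + _); apply: eq_card => x; rewrite !inE; case: (x \in X); case: (x == r);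
  case: (p x \in X).
Qed.

Lemma no_inner_edge x :
  inner_edges = 0 -> x \in X -> x != r -> p x \notin X.
Proof.
move=> inner0 xX x_r; apply/negP => pxX.
by move/eqP: inner0; rewrite cards_eq0 => /eqP/finset.setP/(_ x); rewrite !inE xX x_r pxX.
Qed.

Lemma sum_linear_outside :
  \sum_(y | y \notin X) (1 + 3 * children y) + 3 * inner_edges + 3
    = #|V| + 2 * #|X|.
Proof.
rewrite big_split /= -big_distrr /= sum1_card.
have := cardC X; rewrite -sum_children_outside.
set S := \sum_(_ | _) _; set C := #|[pred y | y \notin X]|; set N := #|V|.
by lia.
Qed.

(** This is [d ^ 2 >= 3 * d - 2] for [d = m.+1], with equality for [d = 1, 2] only. *)
Lemma sqr_ge_linear m : 1 + 3 * m <= m.+1 ^ 2.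
Proof. by case: m => // m; nia. Qed.

Lemma outer_weight_ge : #|V| + 2 * #|X| <= outer_weight + 3 * inner_edges + 3.
Proof.
rewrite -sum_linear_outside -!addnA leq_add2r.
by apply: leq_sum => y _; apply: sqr_ge_linear.
Qed.

Lemma children_le1 :
    outer_weight + 3 * inner_edges + 3 <= #|V| + 2 * #|X| ->
  forall y, y \notin X -> children y <= 1.
Proof.
rewrite -sum_linear_outside -!addnA leq_add2r => weight_le y yX.
rewrite leqNgt; apply/negP => y_gt1; move: weight_le; rewrite leqNgt => /negP[].
rewrite /outer_weight (bigD1 y) // [ltnRHS](bigD1 y) //= -addSn leq_add //.
  by move: y_gt1; case: (children y) => // m; nia.
by apply: leq_sum => v _; apply: sqr_ge_linear.
Qed.

Local Open Scope ring_scope.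
Variables (R : realType) (s : R).

Definition test_vector v : R := if v \in X then s else (children v).+1%:R.

Lemma test_vector_norm :
  \sum_v test_vector v * test_vector v = s ^+ 2 * #|X|%:R + outer_weight%:R.
Proof.
rewrite (bigID (mem X)) /=; congr (_ + _).
  rewrite (eq_bigr (fun=> s ^+ 2)) ?sumr_const ?mulr_natr // => v vX.
  by rewrite /test_vector vX expr2.
rewrite natr_sum; apply: eq_bigr => v vX.
by rewrite /test_vector (negPf vX) natrX expr2.
Qed.

(** Each edge joins a vertex [v != r] to its parent. Edges from [v] outside [X] up
    contribute [s * (children v).+1]; those from [v] in [X] up to [y] outside
    contribute [s * (children y).+1], once for every child of [y]; together they
    make the squares of [outer_weight]. *)
Lemma test_vector_parent :
  \sum_(v | v != r) test_vector (p v) * test_vector v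
    = s * outer_weight%:R + s ^+ 2 * inner_edges%:R.
Proof.
have outer_split : outer_weight
    = (\sum_(y | y \notin X) (children y).+1 + \sum_(y | y \notin X) children y * (children y).+1)%N.
  by rewrite -big_split; apply: eq_bigr => y _ /=; nia.
rewrite (bigID (fun v => v \notin X)) /= outer_split natrD mulrDr -addrA; congr (_ + _).
  rewrite natr_sum big_distrr /=; apply: eq_big => [v|v /andP[v_r vX]].
    by case: (altP (v =P r)) => // ->; rewrite rX.
  by rewrite /test_vector X_cover // (negPf vX).
rewrite (bigID (fun v => p v \notin X)) /=; congr (_ + _).
  rewrite (partition_big p (fun y => y \notin X)) /=; last first.
    by move=> v /andP[_].
  rewrite natr_sum big_distrr /=; apply: eq_bigr => y yX.
  rewrite natrM mulrCA mulr_natl /children -sumr_const.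
  apply: eq_big => [v|v].
    rewrite !inE /child; case: (altP (v =P r)) => //= v_r.
    case: eqP => [pv|_]; last by rewrite !andbF.
    have -> : v \in X by apply: contraNT yX => vX; rewrite -pv X_cover.
    by rewrite pv yX.
  case/andP=> /andP[/andP[_]]; rewrite negbK => vX _ /eqP->.
  by rewrite /test_vector (negPf yX) vX mulrC.
rewrite (eq_bigr (fun=> s ^+ 2)) => [|v]; last first.
  by case/andP=> /andP[_ /negbNE vX] /negbNE pX; rewrite /test_vector vX pX expr2.
rewrite sumr_const mulr_natr; congr (_ *+ _); apply: eq_card => v.
by rewrite !inE unfold_in !negbK -andbA andbCA.
Qed.

Lemma test_vector_tree_form :
  \sum_u (\sum_v (child r p u v + child r p v u)%:R * test_vector v) * test_vector u
    = 2 * (s * outer_weight%:R + s ^+ 2 * inner_edges%:R).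
Proof.
have half : \sum_u \sum_v (child r p u v)%:R * (test_vector v * test_vector u)
    = s * outer_weight%:R + s ^+ 2 * inner_edges%:R.
  rewrite -test_vector_parent [RHS]big_mkcond; apply: eq_bigr => u _ /=.
  rewrite (bigD1 (p u)) //= big1 ?addr0 => [|v /negPf v_pu].
    by rewrite /child eqxx andbT; case: eqP; rewrite ?mul1r ?mul0r.
  by rewrite /child [p u == v]eq_sym v_pu andbF mul0r.
rewrite mulr_natl mulr2n -{1}half -half [X in _ = _ + X]exchange_big -big_split /=.
apply: eq_bigr => u _; rewrite big_distrl -big_split /=; apply: eq_bigr => v _.
by rewrite natrD; ring.
Qed.

Lemma test_vector_gt0 : 0 < s -> forall v, 0 < test_vector v.
Proof. by move=> s_gt0 v; rewrite /test_vector; case: ifP => // _; rewrite ltr0n. Qed.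

End TestVector.

Local Open Scope ring_scope.

(** * The lower bound for one spanning tree *)

Lemma sqrt_bound_sqr (R : realType) (n k : nat) :
    (0 < k)%N -> (2 * k <= n)%N ->
  Num.sqrt ((n%:R + 2 * k%:R - 3) / k%:R) ^+ 2 * k%:R = n%:R + 2 * k%:R - 3 :> R
  /\ 0 < Num.sqrt ((n%:R + 2 * k%:R - 3) / k%:R) :> R.
Proof.
move=> k_gt0 n_ge; have k_gt0R : 0 < k%:R :> R by rewrite ltr0n.
have num_gt0 : 0 < n%:R + 2 * k%:R - 3 :> R.
  have : (2 * k)%:R <= n%:R :> R by rewrite ler_nat.
  have : 1 <= k%:R :> R by rewrite ler1n.
  by rewrite natrM; lra.
rewrite sqr_sqrtr ?divr_ge0 ?ltW // mulfVK ?gt_eqF //; split=> //.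
by rewrite sqrtr_gt0 divr_gt0.
Qed.

Section TreeBound.
Variables (R : realType) (V : finType) (e : rel V).
Variables (r : V) (p : V -> V) (h : V -> nat) (X : {set V}).
Hypotheses (e_sym : symmetric e) (ph : parent_map r p h) (rX : r \in X).
Hypothesis pe : forall v, v != r -> e v (p v).
Hypothesis X_cover : forall v, v != r -> v \notin X -> p v \in X.
Hypothesis X_small : (2 * #|X| <= #|V|)%N.

Let rho : R := spectral_radius R e.
Let s : R := Num.sqrt ((#|V|%:R + 2 * #|X|%:R - 3) / #|X|%:R).
Let z := test_vector r p X s.
Let D : R := (outer_weight r p X)%:R.
Let I : R := (inner_edges r p X)%:R.

Let X_gt0 : (0 < #|X|)%N.
Proof. by apply/card_gt0P; exists r. Qed.

Let V_gt0 : (0 < #|V|)%N.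
Proof. by apply/card_gt0P; exists r. Qed.

Let s_gt0 : 0 < s.
Proof. by have [] := sqrt_bound_sqr R X_gt0 X_small. Qed.

Let s_sqr : s ^+ 2 * #|X|%:R = #|V|%:R + 2 * #|X|%:R - 3.
Proof. by have [] := sqrt_bound_sqr R X_gt0 X_small. Qed.

Lemma child_le_edge u v : (child r p u v + child r p v u <= e u v)%N.
Proof.
have child_edge a b : child r p a b -> e a b by case/andP=> /pe + /eqP <-.
case uv: (child r p u v); first by rewrite (child_asym ph uv) (child_edge _ _ uv).
by case vu: (child r p v u) => //; rewrite e_sym (child_edge _ _ vu).
Qed.

Let edge_form := \sum_u (\sum_v (e u v)%:R * z v) * z u.

Let excess u v : R := ((e u v)%:R - (child r p u v + child r p v u)%:R) * (z v * z u).

Let excess_ge0 u v : 0 <= excess u v.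
Proof.
rewrite mulr_ge0 ?subr_ge0 ?ler_nat ?child_le_edge //.
by rewrite mulr_ge0 // ltW // test_vector_gt0.
Qed.

Let excess_sum : \sum_u \sum_v excess u v = edge_form - 2 * (s * D + s ^+ 2 * I).
Proof.
rewrite -(test_vector_tree_form rX X_cover) -sumrB; apply: eq_bigr => u _.
by rewrite !big_distrl -sumrB; apply: eq_bigr => v _ /=; rewrite /excess mulrBl !mulrA.
Qed.

Let D_ge : s ^+ 2 * #|X|%:R <= D + 3 * I.
Proof.
have : (#|V| + 2 * #|X|)%:R <= (outer_weight r p X + 3 * inner_edges r p X + 3)%:R :> R.
  by rewrite ler_nat outer_weight_ge.
rewrite s_sqr [(#|V| + _)%:R]natrD [(_ + 3)%:R]natrD [(_ + 3 * _)%:R]natrD.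
by rewrite !natrM -/D -/I; lra.
Qed.

(** An edge inside the cover forces the cover to have two vertices, and then
    [X_small] gives [s ^+ 2 >= 5 / 2 > 9 / 4]. *)
Let s_large : (0 < inner_edges r p X)%N -> 3 < 2 * s.
Proof.
move=> I_gt0; have X_gt1 : (1 < #|X|)%N.
  by have := sum_children_outside rX X_cover; lia.
have X_ge2 : 2 <= #|X|%:R :> R by rewrite ler_nat.
have := X_small; rewrite -(ler_nat R) natrM => V_ge.
have s_ge : 5 / 2 <= s ^+ 2.
  rewrite -(ler_pM2r (_ : 0 < #|X|%:R)) ?ltr0n // s_sqr; lra.
rewrite ltNge; apply/negP => s_le.
have : s ^+ 2 <= (3 / 2) ^+ 2 by rewrite lerXn2r ?nnegrE //; [exact: ltW | lra..].
by move: s_ge; rewrite [X in _ <= X -> _]expr2; lra.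
Qed.

Let inner_term_ge0 : 0 <= (2 * s - 3) * I.
Proof.
have [I0|I_gt0] := posnP (inner_edges r p X); first by rewrite /I I0 mulr0.
by rewrite mulr_ge0 ?ler0n // subr_ge0 ltW // s_large.
Qed.

Let norm_gt0 : 0 < \sum_v z v * z v.
Proof.
rewrite (bigD1 r) //= ltr_pwDl ?mulr_gt0 ?test_vector_gt0 // sumr_ge0 // => v _.
by rewrite mulr_ge0 // ltW // test_vector_gt0.
Qed.

(** All the losses of the estimate: the Rayleigh inequality, the edges outside the
    tree, and the two terms of the count. Each of them is nonnegative. *)
Let gap_split : (rho - s) * (\sum_v z v * z v)
  = (rho * (\sum_v z v * z v) - edge_form) + (\sum_u \sum_v excess u v)
    + s * ((D + 3 * I - s ^+ 2 * #|X|%:R) + (2 * s - 3) * I).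
Proof. by rewrite excess_sum (test_vector_norm r p X s) -/D; ring. Qed.

Let rayleigh_gap : 0 <= rho * (\sum_v z v * z v) - edge_form.
Proof. by rewrite subr_ge0; apply: rayleigh_le. Qed.

Let excess_sum_ge0 : 0 <= \sum_u \sum_v excess u v.
Proof. by apply: sumr_ge0 => u _; apply: sumr_ge0. Qed.

Let count_gap : 0 <= D + 3 * I - s ^+ 2 * #|X|%:R.
Proof. by rewrite subr_ge0. Qed.

Lemma tree_bound : s <= rho.
Proof.
rewrite -subr_ge0 -(pmulr_lge0 _ norm_gt0) gap_split.
apply: addr_ge0; first exact: addr_ge0.
by apply: mulr_ge0; [exact: ltW | exact: addr_ge0].
Qed.

Lemma tree_bound_eq : rho = s ->
  [/\ inner_edges r p X = 0%N, forall y, y \notin X -> (children r p y <= 1)%N,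
      forall u v, e u v = child r p u v || child r p v u &
      forall u, \sum_v (e u v)%:R * z v = s * z u].
Proof.
move=> rho_s; have := gap_split; rewrite rho_s subrr mul0r => /esym/eqP.
have slack_ge0 : 0 <= s * (D + 3 * I - s ^+ 2 * #|X|%:R + (2 * s - 3) * I).
  by apply: mulr_ge0; [exact: ltW | exact: addr_ge0].
have := rayleigh_gap; rewrite rho_s => rayleigh_gap_s.
rewrite paddr_eq0 ?(addr_ge0 rayleigh_gap_s) // paddr_eq0 // => /andP[/andP[/eqP rayleigh0 /eqP excess0]].
rewrite mulf_eq0 gt_eqF //= paddr_eq0 // => /andP[/eqP count0 /eqP inner0].
have I0 : inner_edges r p X = 0%N.
  apply/eqP; rewrite eqn0Ngt; apply/negP => I_gt0.
  have : 0 < (2 * s - 3) * I by rewrite mulr_gt0 ?ltr0n // subr_gt0 s_large.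
  by rewrite inner0 ltxx.
split=> //.
- apply: (children_le1 rX X_cover); rewrite -(ler_nat R).
  move: count0; rewrite s_sqr.
  rewrite [(#|V| + _)%:R]natrD [(_ + 3)%:R]natrD [(_ + 3 * _)%:R]natrD.
  by rewrite !natrM -/D -/I; lra.
- move=> u v; have /eqP : excess u v = 0.
    move: excess0 => /eqP; rewrite psumr_eq0 => [/allP/(_ u)|? _]; last exact: sumr_ge0.
    rewrite mem_index_enum psumr_eq0 => [/(_ isT)/allP/(_ v)|//].
    by rewrite mem_index_enum => /(_ isT)/eqP.
  rewrite mulf_eq0 subr_eq0 eqr_nat mulf_eq0 ![z _ == 0]gt_eqF ?test_vector_gt0 //.
  rewrite !orbF => /eqP; have := child_le_edge u v.
  by case: (e u v); case: (child r p u v); case: (child r p v u).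
- rewrite -rho_s; apply: rayleigh_eigenvector => //.
  by apply/eqP; rewrite -subr_eq0 -opprB oppr_eq0 -/edge_form -/rho rho_s rayleigh0.
Qed.

End TreeBound.

Local Close Scope ring_scope.

(** * Recognizing subdivided trees with leaves *)

Lemma card_edges_at (T : finType) (t : rel T) (x : T) :
    symmetric t -> irreflexive t ->
  #|[set a in edges t | x \in a]| = degree t x.
Proof.
move=> t_sym t_irr.
rewrite /degree -(card_in_imset (f := fun y => [set x; y])) /=; last first.
  move=> y y'; rewrite !inE => txy txy' /finset.setP/(_ y).
  rewrite !inE eqxx orbT => /esym/orP[]/eqP // yx.
  by move: txy; rewrite yx t_irr.
apply: eq_card => a; rewrite inE; apply/andP/imsetP => [[/edgesP[u [v [tuv ->]]]]|[y]].
  rewrite !inE => /orP[]/eqP->; first by exists v; rewrite ?inE.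
  by exists u; rewrite ?inE 1?t_sym // finset.setUC.
rewrite inE => txy ->; split; last by rewrite finset.set21.
by apply/edgesP; exists x, y.
Qed.

(** A subdivision vertex is known by its set of neighbours, an edge of the tree; a
    leaf only up to exchanging the leaves at the same vertex. So a graph is a
    subdivided tree with leaves as soon as these sets of neighbours are right, and
    the number of leaves follows from the sum in [nbhd_sum], where a subdivision
    vertex counts for two and a leaf for one. *)
Section SubdividedIsomorphism.
Variables (T V : finType) (t : rel T) (e : rel V) (g : T -> V) (c : nat).
Hypotheses (t_sym : symmetric t) (t_irr : irreflexive t) (e_sym : symmetric e).
Hypothesis g_inj : injective g.

Let nbhd y := [set x | e (g x) y].

Hypothesis g_indep : forall x x', e (g x) (g x') = false.
Hypothesis out_indep : forall y y',
  y \notin codom g -> y' \notin codom g -> e y y' = false.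
Hypothesis nbhd_shape : forall y, y \notin codom g ->
  nbhd y \in edges t \/ exists x, nbhd y = [set x].
Hypothesis nbhd_onto : forall a, a \in edges t ->
  exists y, y \notin codom g /\ nbhd y = a.
Hypothesis nbhd_inj : forall y y', y \notin codom g -> y' \notin codom g ->
  nbhd y \in edges t -> nbhd y = nbhd y' -> y = y'.
Hypothesis nbhd_sum : forall x, \sum_(y | e (g x) y) #|nbhd y| = c.

Let leaves x := [set y | (y \notin codom g) && (nbhd y == [set x])].

Let set1_not_edge x : ([set x] \in edges t) = false.
Proof. by apply/negP => /(card_edge t_irr); rewrite cards1. Qed.

Let nbr_out x y : e (g x) y -> y \notin codom g.
Proof. by move=> exy; apply/negP => /codomP[x' y_x']; rewrite y_x' g_indep in exy. Qed.

Lemma leaves_count x : 2 * degree t x + #|leaves x| = c.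
Proof.
rewrite -(nbhd_sum x) (bigID (fun y => nbhd y \in edges t)) /=; congr (_ + _).
  rewrite (eq_bigr (fun=> 2)) => [|y /andP[_]]; last exact: card_edge.
  rewrite sum_nat_const mulnC; congr (_ * _).
  rewrite -card_edges_at // -(card_in_imset (f := nbhd)) /=; last first.
    move=> y y' /andP[/nbr_out yg yE] /andP[/nbr_out y'g _]; exact: nbhd_inj.
  apply: eq_card => a; rewrite !inE; apply/andP/imsetP => [[aE xa]|[y]].
    have [y [yg y_a]] := nbhd_onto aE; exists y => //.
    by rewrite unfold_in y_a aE andbT; move: xa; rewrite -y_a inE.
  by rewrite unfold_in => /andP[exy yE] ->; rewrite inE.
rewrite -sum1_card; apply: eq_big => [y|y].
  rewrite inE; apply/andP/andP => [[yg /eqP y_x]|[exy yE]].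
    have : x \in nbhd y by rewrite y_x finset.set11.
    by rewrite inE y_x set1_not_edge.
  have yg := nbr_out exy; split=> //.
  have [|[x' y_x']] := nbhd_shape yg; first by rewrite (negPf yE).
  have : x \in nbhd y by rewrite inE.
  by rewrite y_x' inE => /eqP->.
by rewrite inE => /andP[_ /eqP->]; rewrite cards1.
Qed.

Lemma degree_double_le x : 2 * degree t x <= c.
Proof. by rewrite -(leaves_count x) leq_addr. Qed.

Let leaves_card x : #|leaves x| = c - 2 * degree t x.
Proof. by rewrite -(leaves_count x) addKn. Qed.

Lemma subdivided_isomorphism :
  isomorphic (@subdivided_rel _ t (fun x => c - 2 * degree t x)) e.
Proof.
have /fin_all_exists[mid midP] (a : {a | a \in edges t}) :
  exists y, y \notin codom g /\ nbhd y = val a by apply: nbhd_onto; apply: valP.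
pose leaf (l : {x : T & 'I_(c - 2 * degree t x)}) : V :=
  enum_val (cast_ord (esym (leaves_card (tag l))) (tagged l)).
have leafP l : leaf l \notin codom g /\ nbhd (leaf l) = [set tag l].
  have := enum_valP (cast_ord (esym (leaves_card (tag l))) (tagged l)).
  by rewrite inE => /andP[? /eqP].
pose phi (u : subdivided_vertex t (fun x => c - 2 * degree t x)) : V :=
  match u with inl (inl x) => g x | inl (inr a) => mid a | inr l => leaf l end.
have nbhdE x y : e (g x) y = (x \in nbhd y) by rewrite inE.
have gP x : g x \in codom g by apply: codom_f.
have phi_inj : injective phi.
  have leaf_mid a l : mid a <> leaf l.
    have [[_ a_nbhd] [_ l_nbhd]] := (midP a, leafP l) => al.
    by have := valP a; rewrite /= -a_nbhd al l_nbhd set1_not_edge.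
  have g_mid x a : g x <> mid a.
    by move=> xa; have [] := midP a; rewrite -xa gP.
  have g_leaf x l : g x <> leaf l.
    by move=> xl; have [] := leafP l; rewrite -xl gP.
  case=> [[x|a]|l] [[x'|a']|l'] //=; try by [move/g_inj->|move/g_mid|move/g_leaf
    |move/esym/g_mid|move/esym/g_leaf|move/leaf_mid|move/esym/leaf_mid].
    move=> aa'; congr (inl (inr _)); apply: val_inj.
    by rewrite -(midP a).2 -(midP a').2 aa'.
  move=> ll'; congr inr; have tag_ll' : tag l = tag l'.
    by apply: finset.set1_inj; rewrite -(leafP l).2 -(leafP l').2 ll'.
  case: l l' tag_ll' ll' => [x i] [x' i'] /= xx'; rewrite -xx' in i' *.
  by move=> /enum_val_inj/cast_ord_inj /= ->.
have phi_onto v : exists u, phi u = v.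
  have [/codomP[x ->]|vg] := boolP (v \in codom g); first by exists (inl (inl x)).
  have [vE|[x v_x]] := nbhd_shape vg.
    pose a : {a | a \in edges t} := exist (fun a => a \in edges t) _ vE.
    exists (inl (inr a)); have [ag a_v] := midP a.
    by apply: nbhd_inj => //; rewrite a_v.
  have v_leaf : v \in leaves x by rewrite inE vg v_x eqxx.
  exists (inr (Tagged (fun x => 'I_(c - 2 * degree t x)) (cast_ord (leaves_card x) (enum_rank_in v_leaf v)))).
  by rewrite /= /leaf /= cast_ordK enum_rankK_in.
have [psi psiK] := fin_all_exists phi_onto.
exists phi.
  by exists psi => // u; apply: phi_inj; rewrite psiK.
case=> [[x|a]|l] [[x'|a']|l'] /=.
- exact: g_indep.
- by rewrite nbhdE (midP a').2.
- by rewrite nbhdE (leafP l').2 inE.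
- by rewrite e_sym nbhdE (midP a).2.
- by rewrite out_indep // ?(midP _).1.
- by rewrite out_indep // ?(midP _).1 ?(leafP _).1.
- by rewrite e_sym nbhdE (leafP l).2 inE.
- by rewrite out_indep // ?(midP _).1 ?(leafP _).1.
- by rewrite out_indep // ?(leafP _).1.
Qed.

End SubdividedIsomorphism.

Local Open Scope ring_scope.

(** * The spectral radius of a subdivided tree with leaves *)

Definition subdivided_vector (R : realType) (T : finType) (t : rel T) (f : T -> nat)
    (c : nat) (u : subdivided_vertex t f) : R :=
  match u with inl (inl _) => Num.sqrt c%:R | inl (inr _) => 2 | inr _ => 1 end.

(** The row of [x] adds up to [2 * degree t x + f x = c], and [f] is chosen for that;
    the rows of the other vertices add up to [sqrt c] times their degree. *)
Lemma subdivided_vector_eigen (R : realType) (T : finType) (t : rel T) (c : nat) :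
    symmetric t -> irreflexive t -> (forall x, (2 * degree t x <= c)%N) ->
  let f x := (c - 2 * degree t x)%N in
  forall u, \sum_v (@subdivided_rel _ t f u v)%:R * subdivided_vector R c v
    = Num.sqrt c%:R * subdivided_vector R c u.
Proof.
move=> t_sym t_irr deg_le f u; rewrite !big_sumType /=.
case: u => [[x|a]|[x i]] /=.
- rewrite big1 ?add0r => [|? _]; last by rewrite mul0r.
  rewrite -expr2 sqr_sqrtr ?ler0n // -!big_distrl /= mulr1.
  have -> : \sum_(a : {a | a \in edges t}) (x \in val a)%:R = (degree t x)%:R :> R.
    rewrite -natr_sum; congr _%:R; rewrite -card_edges_at // -sum1dep_card.
    rewrite (big_sub_cond (mem (edges t))) [RHS]big_mkcond /=.
    by apply: eq_bigr => a _; case: (x \in _).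
  have -> : \sum_(l : {x : T & 'I_(f x)}) (x == tag l)%:R = (f x)%:R :> R.
    rewrite -(sig_big_dep (fun=> true) (fun _ _ => true) (fun y _ => (x == y)%:R)) /=.
    rewrite (bigD1 x) //= eqxx sumr_const card_ord [X in _ + X]big1 ?addr0 // => y yx.
    by rewrite big1 // => ? _; rewrite eq_sym (negPf yx).
  by rewrite -natrM -natrD /f mulnC subnKC.
- rewrite [X in _ + X + _]big1 => [|? _]; last by rewrite mul0r.
  rewrite [X in _ + X]big1 => [|? _]; last by rewrite mul0r.
  rewrite !addr0 -big_distrl /= mulrC; congr (_ * _).
  rewrite -natr_sum; congr _%:R; rewrite -(card_edge t_irr (valP a)) -sum1_card.
  by rewrite [RHS]big_mkcond /=; apply: eq_bigr => x _; case: (x \in _).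
- rewrite [X in _ + X + _]big1 => [|? _]; last by rewrite mul0r.
  rewrite [X in _ + X]big1 => [|? _]; last by rewrite mul0r.
  rewrite !addr0 mulr1 (bigD1 x) //= eqxx mul1r big1 ?addr0 // => y yx.
  by rewrite (negPf yx) mul0r.
Qed.

Lemma subdivided_spectral_radius (R : realType) (T V : finType) (t : rel T)
    (e : rel V) (c : nat) :
    (0 < #|T|)%N -> (0 < c)%N ->
    symmetric t -> irreflexive t -> (forall x, (2 * degree t x <= c)%N) ->
    symmetric e ->
    isomorphic (@subdivided_rel _ t (fun x => (c - 2 * degree t x)%N)) e ->
  spectral_radius R e = Num.sqrt c%:R.
Proof.
move=> /card_gt0P[x0 _] c_gt0 t_sym t_irr deg_le e_sym [f f_bij fE].
have [f' fK f'K] := f_bij.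
apply: (positive_eigenvector (f := fun v => subdivided_vector R c (f' v))) => //.
- by apply/card_gt0P; exists (f (inl (inl x0))).
- by move=> v; case: (f' v) => [[?|?]|?] //=; rewrite ?sqrtr_gt0 ltr0n.
- move=> u; rewrite -subdivided_vector_eigen // (reindex f) /=; last exact: onW_bij.
  by apply: eq_bigr => w _; rewrite fK -fE f'K.
Qed.

Local Close Scope ring_scope.

(** * The grandparent tree *)

Definition parent_graph (T : eqType) (r : T) (p : T -> T) : rel T :=
  fun u v => child r p u v || child r p v u.

(** On a cycle, both neighbours of a highest vertex would be its parent. *)
Lemma parent_graph_tree (T : finType) (r : T) (p : T -> T) (h : T -> nat) :
  parent_map r p h -> tree (parent_graph r p).
Proof.
move=> ph; have sym : symmetric (parent_graph r p) by move=> u v; apply: orbC.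
split.
- split=> // u; rewrite /parent_graph orbb; apply/negP => uu.
  by have := child_asym ph uu; rewrite uu.
- split=> [|u v]; first by apply/card_gt0P; exists r.
  suff to_root w : connect (parent_graph r p) w r.
    by apply: connect_trans (to_root u) _; rewrite (sym_connect_sym sym).
  have [n] := ubnP (h w); elim: n w => // n IHn w; rewrite ltnS => h_le.
  have [->|w_r] := eqVneq w r; first exact: connect0.
  apply: connect_trans (IHn (p w) (leq_trans (ph _ w_r) h_le)).
  by apply: connect1; rewrite /parent_graph /child w_r eqxx.
- case=> // x0 c0 c_size /andP[c_cycle c_uniq]; set c := x0 :: c0 in c_size c_cycle c_uniq.
  have [x xc x_max] := @arg_maxnP _ x0 (mem c) h (mem_head x0 c0).
  have [i s c_rot] := rot_to xc.
  have : cycle (parent_graph r p) (x :: s) by rewrite -c_rot rot_cycle.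
  have : uniq (x :: s) by rewrite -c_rot rot_uniq.
  have : 2 < size (x :: s) by rewrite -c_rot size_rot.
  have parent_of y : y \in x :: s -> parent_graph r p x y -> y = p x.
    rewrite -c_rot mem_rot => yc /orP[/andP[_ /eqP->]//|/andP[y_r /eqP pyx]].
    by have := ph y y_r; rewrite pyx ltnNge (x_max y yc : h y <= h x).
  case: s {c_rot} parent_of => [|y s] //; case/lastP: s => [|s z] // parent_of _.
  rewrite /= rcons_path last_rcons mem_rcons inE => /and3P[_ /norP[y_z _] _].
  case/and3P=> xy _ zx; case/eqP: y_z.
  have -> : y = p x by apply: parent_of => //; rewrite !inE eqxx orbT.
  by apply/esym/parent_of; rewrite 1?sym // inE inE mem_rcons inE eqxx !orbT.
Qed.

(** If the cover is independent and every vertex outside has at most one child,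
    then every vertex outside subdivides the edge from its child to its parent,
    or is a leaf. The tree on the cover is the grandparent tree. *)
Section GrandparentTree.
Variables (V : finType) (e : rel V) (r : V) (p : V -> V) (h : V -> nat).
Variables (X : {set V}) (c : nat).
Hypotheses (ph : parent_map r p h) (rX : r \in X).
Hypothesis X_cover : forall v, v != r -> v \notin X -> p v \in X.
Hypothesis X_indep : inner_edges r p X = 0.
Hypothesis few_children : forall y, y \notin X -> children r p y <= 1.
Hypothesis eE : forall u v, e u v = parent_graph r p u v.
Hypothesis row_sum : forall x, x \in X -> \sum_(y | e x y) (children r p y).+1 = c.

Let g : 'I_#|X| -> V := enum_val.
Let gi : V -> 'I_#|X| := enum_rank_in rX.
Let q i := gi (p (p (g i))).
Let t := parent_graph (gi r) q.

Let giK v : v \in X -> g (gi v) = v.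
Proof. exact: enum_rankK_in. Qed.

Let gX i : g i \in X.
Proof. exact: enum_valP. Qed.

Let gK : cancel g gi.
Proof. exact: enum_valK_in. Qed.

Let codom_g v : (v \in codom g) = (v \in X).
Proof.
apply/codomP/idP => [[i ->]//|vX].
by exists (gi v); rewrite giK.
Qed.

Let root_eq i : (i == gi r) = (g i == r).
Proof. by rewrite -(inj_eq (can_inj gK)) giK. Qed.

Let parent_out x : x \in X -> x != r -> p x \notin X.
Proof. exact: no_inner_edge. Qed.

Let out_root y : y \notin X -> y != r.
Proof. by apply: contraNneq => ->. Qed.

Let grandparent x : x \in X -> x != r -> p (p x) \in X.
Proof. by move=> xX /(parent_out xX) pxX; apply: X_cover => //; apply: out_root. Qed.

Let gq i : i != gi r -> g (q i) = p (p (g i)).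
Proof. by rewrite root_eq => i_r; rewrite /q giK // grandparent. Qed.

Let q_parent : parent_map (gi r) q (h \o g).
Proof.
move=> i i_r /=; rewrite gq //; rewrite root_eq in i_r.
by apply: ltn_trans (ph i_r); apply: ph; apply/out_root/parent_out.
Qed.

Let nbhd y := [set i | e (g i) y].

Let nbhdE y i : y \notin X ->
  (i \in nbhd y) = (g i != r) && (p (g i) == y) || (p y == g i).
Proof. by move=> yX; rewrite inE eE /parent_graph /child (out_root yX). Qed.

Let nbhd_parent i : i != gi r -> nbhd (p (g i)) = [set i; q i].
Proof.
move=> i_r; have := i_r; rewrite root_eq => gi_r.
have yX := parent_out (gX i) gi_r.
apply/finset.setP => j; rewrite nbhdE // !inE -gq // (inj_eq (can_inj gK)) [q i == j]eq_sym.
congr (_ || _); apply/andP/eqP => [[gj_r /eqP pj]|->]; last by rewrite gi_r.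
apply: (can_inj gK); apply: (card_le1_eqP (few_children yX)).
  by rewrite inE /child gi_r eqxx.
by rewrite inE /child gj_r pj eqxx.
Qed.

Let nbhd_childless y : y \notin X -> children r p y = 0 -> nbhd y = [set gi (p y)].
Proof.
move=> yX /eqP; rewrite cards_eq0 => /eqP no_child.
apply/finset.setP => i; rewrite nbhdE // inE.
have -> : (g i != r) && (p (g i) == y) = false.
  by move/finset.setP/(_ (g i)): no_child; rewrite !inE.
by rewrite -(inj_eq (can_inj gK)) giK ?X_cover ?out_root // eq_sym.
Qed.

Let outside_cases y : y \notin X ->
  (nbhd y = [set gi (p y)] /\ children r p y = 0) \/
  exists i, [/\ i != gi r, y = p (g i), nbhd y = [set i; q i] & children r p y = 1].
Proof.
move=> yX; have := few_children yX; rewrite leq_eqVlt ltnS leqn0.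
case/orP=> /eqP ch; last by left; rewrite nbhd_childless.
right; have /card_gt0P[w] : 0 < children r p y by rewrite ch.
rewrite inE => /andP[w_r /eqP pw].
have wX : w \in X by apply: contraNT yX => wX; rewrite -pw X_cover.
have gw : g (gi w) = w by apply: giK.
have i_r : gi w != gi r by rewrite root_eq gw.
by exists (gi w); rewrite -(nbhd_parent i_r) gw pw.
Qed.

Let t_sym : symmetric t.
Proof. by case: (parent_graph_tree q_parent) => -[]. Qed.

Let t_irr : irreflexive t.
Proof. by case: (parent_graph_tree q_parent) => -[]. Qed.

Let edge_parent i : i != gi r -> [set i; q i] \in edges t.
Proof.
move=> i_r; apply/edgesP; exists i, (q i); split=> //.
by rewrite /t /parent_graph /child i_r eqxx.
Qed.

Let card_nbhd y : y \notin X -> #|nbhd y| = (children r p y).+1.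
Proof.
case/outside_cases=> [[-> ->]|[i [i_r _ -> ->]]]; first by rewrite cards1.
exact: (card_edge t_irr (edge_parent i_r)).
Qed.

Let nbhd_edge y : y \notin X -> nbhd y \in edges t ->
  exists i, [/\ i != gi r, y = p (g i) & nbhd y = [set i; q i]].
Proof.
move=> yX yE; case: (outside_cases yX) => [[y_b _]|[i [i_r y_i nbhd_y _]]].
  by have := card_edge t_irr yE; rewrite y_b cards1.
by exists i.
Qed.

Lemma grandparent_tree_isomorphism :
  exists t' : rel 'I_#|X|, [/\ tree t', forall i, 2 * degree t' i <= c &
    isomorphic (@subdivided_rel _ t' (fun i => c - 2 * degree t' i)) e].
Proof.
have e_sym : symmetric e by move=> u v; rewrite !eE; apply: orbC.
have g_indep i j : e (g i) (g j) = false.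
  rewrite eE; apply/negP => /orP[]/andP[g_r /eqP pg].
    by have := parent_out (gX i) g_r; rewrite pg gX.
  by have := parent_out (gX j) g_r; rewrite pg gX.
have out_indep y y' : y \notin codom g -> y' \notin codom g -> e y y' = false.
  rewrite !codom_g eE => yX y'X; apply/negP => /orP[]/andP[y_r /eqP py].
    by have := X_cover y_r yX; rewrite py (negPf y'X).
  by have := X_cover y_r y'X; rewrite py (negPf yX).
have nbhd_shape y : y \notin codom g -> nbhd y \in edges t \/ exists i, nbhd y = [set i].
  rewrite codom_g => /outside_cases[[-> _]|[i [i_r _ -> _]]]; first by right; exists (gi (p y)).
  by left; apply: edge_parent.
have nbhd_onto a : a \in edges t -> exists y, y \notin codom g /\ nbhd y = a.
  case/edgesP=> i [j [tij ->]].
  wlog /andP[i_r /eqP qi] : i j {tij} / child (gi r) q i j.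
    move=> IH; case/orP: tij => [/IH//|/IH[y [yg y_ji]]].
    by exists y; rewrite finset.setUC.
  exists (p (g i)); rewrite codom_g nbhd_parent // qi; split=> //.
  by rewrite parent_out // -root_eq.
have nbhd_inj y y' : y \notin codom g -> y' \notin codom g ->
    nbhd y \in edges t -> nbhd y = nbhd y' -> y = y'.
  rewrite !codom_g => yX y'X yE yy'; have y'E := yE; rewrite yy' in y'E.
  have [i [i_r yE_i y_i]] := nbhd_edge yX yE.
  have [j [j_r y'E_j y'_j]] := nbhd_edge y'X y'E.
  move: yy'; rewrite y_i y'_j => ij; rewrite yE_i y'E_j.
  have : i \in [set j; q j] by rewrite -ij finset.set21.
  have : j \in [set i; q i] by rewrite ij finset.set21.
  rewrite !inE => /orP[/eqP->//|/eqP ji] /orP[/eqP->//|/eqP jj].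
  have := q_parent i_r; have := q_parent j_r; rewrite -ji -jj /= => h1 h2.
  by have := ltn_trans h1 h2; rewrite ltnn.
have nbhd_sum i : \sum_(y | e (g i) y) #|nbhd y| = c.
  rewrite -(row_sum (gX i)); apply: eq_bigr => y eiy; apply: card_nbhd.
  by apply/negP => yX; move: eiy; rewrite -(giK yX) g_indep.
exists t; split; first exact: parent_graph_tree q_parent.
  exact: (degree_double_le t_sym t_irr g_indep nbhd_shape nbhd_onto nbhd_inj nbhd_sum).
exact: (subdivided_isomorphism t_sym t_irr e_sym (can_inj gK) g_indep out_indep
  nbhd_shape nbhd_onto nbhd_inj nbhd_sum).
Qed.

End GrandparentTree.

Local Open Scope ring_scope.

(** * The theorem *)

(** The bound is [2 + (n - 3) / k] under the root, and [k' < k] forces [n >= 4]. *)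
Lemma sqrt_bound_antitone (R : realType) (n k k' : nat) :
    (0 < k')%N -> (k' < k)%N -> (2 * k <= n)%N ->
  Num.sqrt ((n%:R + 2 * k%:R - 3) / k%:R)
    < Num.sqrt ((n%:R + 2 * k'%:R - 3) / k'%:R) :> R.
Proof.
move=> k'_gt0 k'_lt n_ge.
have k_gt0 : (0 < k)%N by apply: leq_trans k'_lt.
have k'R : 0 < k'%:R :> R by rewrite ltr0n.
have kR : 0 < k%:R :> R by rewrite ltr0n.
have k'_ltR : k'%:R < k%:R :> R by rewrite ltr_nat.
have n_ge4 : 4 <= n%:R :> R by rewrite ler_nat; lia.
rewrite ltr_sqrt; last by rewrite divr_gt0 //; lra.
rewrite ltr_pdivrMr // mulrAC ltr_pdivlMr //; nra.
Qed.

Lemma in_family_quotient (n k : nat) : (0 < k)%N -> (2 * k <= n)%N ->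
  (k%:Z %| (n%:Z - 3)%R)%Z <-> (((n + 2 * k - 3) %/ k) * k = n + 2 * k - 3)%N.
Proof.
move=> k_gt0 n_ge; split=> [/dvdzP[m m_eq]|c_eq].
  apply: divnK; suff : (k%:Z %| (n + 2 * k - 3)%N%:Z)%Z by [].
  apply/dvdzP; exists (m + 2); rewrite mulrDl -m_eq; lia.
apply/dvdzP; exists (((n + 2 * k - 3) %/ k)%N%:Z - 2).
by rewrite mulrBl -PoszM c_eq; lia.
Qed.

Lemma sqrt_bound_nat (R : realType) (n k : nat) : (0 < k)%N -> (2 * k <= n)%N ->
    (((n + 2 * k - 3) %/ k) * k = n + 2 * k - 3)%N ->
  (n%:R + 2 * k%:R - 3) / k%:R = ((n + 2 * k - 3) %/ k)%:R :> R.
Proof.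
move=> k_gt0 n_ge c_eq; apply: (canLR (mulfK _)); first by rewrite pnatr_eq0 -lt0n.
by rewrite -[RHS]natrM c_eq natrB ?[(n + _)%:R]natrD ?natrM //; lia.
Qed.

Lemma in_family_spectral_radius (R : realType) (n k : nat) (V : finType) (e : rel V) :
    symmetric e -> in_family n k e ->
  spectral_radius R e = Num.sqrt ((n%:R + 2 * k%:R - 3) / k%:R).
Proof.
move=> e_sym [_ k_gt0 k_dvd n_ge [t [[[t_sym t_irr] _ _] deg_le t_iso]]].
have c_eq := (in_family_quotient k_gt0 n_ge).1 k_dvd; rewrite sqrt_bound_nat ?c_eq //.
apply: subdivided_spectral_radius t_iso => //; first by rewrite card_ord.
by rewrite divn_gt0 //; lia.
Qed.

Theorem theorem3 (R : realType) (n k : nat) (V : finType) (e : rel V)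
    (k_gt0 : (0 < k)%N) (e_simple : simple_graph e) (e_conn : connected_graph e)
    (order_e : #|V| = n) (matching_e : matching_number e = k) :
  Num.sqrt ((n%:R + 2 * k%:R - 3) / k%:R) <= spectral_radius R e /\
  (spectral_radius R e = Num.sqrt ((n%:R + 2 * k%:R - 3) / k%:R) <->
   in_family n k e).
Proof.
have [e_sym e_irr] := e_simple.
have n_ge : (2 * k <= n)%N by rewrite -matching_e -order_e matching_number_double.
have V_gt1 : (1 < #|V|)%N by rewrite order_e; lia.
have [r [p [h [X [ph pe rX X_cover X_le]]]]] := rooted_cover e_sym e_conn V_gt1.
rewrite matching_e in X_le.
have X_gt0 : (0 < #|X|)%N by apply/card_gt0P; exists r.
have X_small : (2 * #|X| <= #|V|)%N by rewrite order_e; lia.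
have := tree_bound R e_sym ph rX pe X_cover X_small; rewrite order_e => rho_ge.
have [X_lt|k_le] := ltnP #|X| k.
  have lt_rho := lt_le_trans (sqrt_bound_antitone R X_gt0 X_lt n_ge) rho_ge.
  split; first exact: ltW.
  split=> [rho_eq|]; last exact: in_family_spectral_radius.
  by rewrite rho_eq ltxx in lt_rho.
have X_k : #|X| = k by apply/eqP; rewrite eqn_leq X_le.
rewrite X_k in rho_ge; split=> //; split; last exact: in_family_spectral_radius.
move=> rho_eq.
have := tree_bound_eq e_sym ph rX pe X_cover X_small.
rewrite order_e X_k => /(_ R rho_eq) [inner0 few_children eE eigen].
set s := Num.sqrt _ in eigen rho_eq.
have [s_sqr s_gt0] := sqrt_bound_sqr R k_gt0 n_ge; rewrite -/s in s_sqr s_gt0.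
(* The row of [x] in the eigenvector equation; both sides are natural numbers, which
   gives the divisibility as well. *)
have row_sum x : x \in X ->
    ((\sum_(y | e x y) (children r p y).+1) * k = n + 2 * k - 3)%N.
  move=> xX; apply/eqP; rewrite -(eqr_nat R) natrB; last lia.
  rewrite natrM [(n + _)%:R]natrD [(2 * k)%:R]natrM -s_sqr; apply/eqP; congr (_ * _).
  have := eigen x; rewrite {2}/test_vector xX -expr2 => <-.
  rewrite natr_sum big_mkcond; apply: eq_bigr => y _.
  case exy: (e x y); rewrite ?mul0r ?mul1r // /test_vector.
  suff /negPf -> : y \notin X by [].
  move: exy; rewrite eE => /orP[/andP[x_r /eqP <-]|/andP[y_r /eqP py]].
    exact: no_inner_edge inner0 xX x_r.
  by apply: contraL xX => yX; rewrite -py (no_inner_edge inner0 yX y_r).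
have c_eq : (((n + 2 * k - 3) %/ k) * k = n + 2 * k - 3)%N.
  by apply: divnK; rewrite -(row_sum r rX) dvdn_mull.
split=> //; [lia | exact/(in_family_quotient k_gt0 n_ge) | ].
rewrite -X_k; apply: (grandparent_tree_isomorphism ph rX X_cover inner0 few_children eE).
move=> x xX; apply/eqP; rewrite -(eqn_pmul2r k_gt0) X_k c_eq; apply/eqP.
exact: row_sum.
Qed.
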